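(* For each end-of-file dead segment language, considering variant E of the halting problem, $$\forall c > 0: \exists T_c \in \textnormal{three-way(E)}: \forall n \in \mathbb{N}: \frac{\overline h_{T_c}(n)+\overline d_{T_c}(n)}{p(n)} \leq c .$$ The same holds with approx(E) or generic(E) in place of three-way(E).
   Context: Programs are strings over a finite alphabet $\Sigma$ ($|\Sigma|\ge2$); each program on each input halts or runs forever; $p(n)$ is the number of programs of size (length) $n$. The language is end-of-file dead segment if each program is the concatenation of an actual program, written in a self-delimiting language (the set of actual programs is decidable and none is a proper prefix of another), and a dead segment, an arbitrary string over $\Sigma$ extending to the end of the file; the actual program cannot read the dead segment, so the behaviour of a program is determined by its actual program. Variant E: instances are programs; question: does the program halt on the empty input. A three-way tester always halts with ``yes'', ``no'' or ``I don't know'', where ``yes''/``no'' must be correct; a generic-case tester on each instance either halts with a correct ``yes''/``no'' or fails to halt; an approximating tester always halts with ``yes'' or ``no'', possibly incorrect. three-way(E), generic(E), approx(E) are the sets of these testers. An instance is hard for a tester unless the tester answers it correctly with ``yes'' or ``no''. $\overline h_T(n)$, $\overline d_T(n)$ are the numbers of hard halting and hard non-halting instances of size $n$. *)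

(* Defs.v *)
From HB Require Import structures.
From mathcomp Require Export all_boot all_order all_algebra.
From mathcomp Require Export boolp reals.

Set Implicit Arguments.
Unset Strict Implicit.
Unset Printing Implicit Defensive.

Import Order.TTheory GRing.Theory Num.Theory.

(* Computability is fixed to be computability by deterministic one-tape Turing
   machines.  The input is a word over [Sigma]; the tape alphabet is
   [option (Sigma + W)], where [None] is the blank and [W] is a finite set of
   additional work symbols.  [tm_answer q = Some a] means that [q] is a halting
   state in which the machine answers [a]. *)
Inductive direction := MoveLeft | Stay | MoveRight.

Definition offset (m : direction) : int :=
  match m with
  | MoveLeft => (-1)%R
  | Stay => 0%R
  | MoveRight => 1%R
  end.

Record tm (Sigma : finType) (A : Type) := TM {
  tm_state : finType;
  tm_work : finType;
  tm_start : tm_state;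
  tm_answer : tm_state -> option A;
  tm_delta : tm_state -> option (Sigma + tm_work) ->
             tm_state * option (Sigma + tm_work) * direction
}.

Section TuringMachines.
Variables (Sigma : finType) (A : Type) (M : tm Sigma A).

Record tm_config := TMConfig {
  cfg_state : tm_state M;
  cfg_head : int;
  cfg_tape : int -> option (Sigma + tm_work M)
}.

Definition tm_init (w : seq Sigma) : tm_config :=
  TMConfig (tm_start M) 0%R
    (fun z => if z is Posz i then omap inl (onth w i) else None).

Definition tm_step (c : tm_config) : tm_config :=
  if tm_answer (cfg_state c) is Some _ then c
  else
    let: (q, s, m) := tm_delta (cfg_state c) (cfg_tape c (cfg_head c)) in
    TMConfig q (cfg_head c + offset m)%R
      (fun z => if z == cfg_head c then s else cfg_tape c z).

Definition halts_with (w : seq Sigma) (a : A) : Prop :=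
  exists k : nat, tm_answer (cfg_state (iter k tm_step (tm_init w))) = Some a.

End TuringMachines.

Definition decidable_words (Sigma : finType) (S : pred (seq Sigma)) : Prop :=
  exists M : tm Sigma bool, forall w, halts_with M w (S w).

(* [run x i] is the output of the program [x] on the input [i], [None] meaning
   that [x] runs forever on [i].  It is meaningless if [x] is not a program. *)
Record language (Sigma : finType) := Language {
  is_program : pred (seq Sigma);
  run : seq Sigma -> seq Sigma -> option (seq Sigma)
}.

Definition self_delimiting (Sigma : finType) (S : pred (seq Sigma)) : Prop :=
  decidable_words S /\
  forall q q', S q -> S q' -> prefix q q' -> q = q'.

Definition eof_dead_segment (Sigma : finType) (L : language Sigma) : Prop :=
  exists actual : pred (seq Sigma),
    [/\ self_delimiting actual,
        forall x, is_program L x <-> exists q d, x = q ++ d /\ actual q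
      & forall q d, actual q -> run L (q ++ d) =1 run L q].

Inductive verdict := Yes | No | DontKnow.

Section VariantE.
Variables (Sigma : finType) (L : language Sigma).
Implicit Types (T : tm Sigma verdict) (x : seq Sigma) (n : nat).

Definition haltsE x : bool := isSome (run L x [::]).

Definition correct_on T x : Prop :=
  (halts_with T x Yes /\ haltsE x) \/ (halts_with T x No /\ ~~ haltsE x).

Definition three_wayE T : Prop :=
  forall x, is_program L x -> correct_on T x \/ halts_with T x DontKnow.

Definition genericE T : Prop :=
  forall x, is_program L x ->
    correct_on T x \/ (forall v, ~ halts_with T x v).

Definition approxE T : Prop :=
  forall x, is_program L x -> halts_with T x Yes \/ halts_with T x No.

Definition hard T x : Prop := ~ correct_on T x.

Definition num_programs n : nat :=
  #|[set x : n.-tuple Sigma | is_program L x]|.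

Definition hard_halting T n : nat :=
  #|[set x : n.-tuple Sigma | [&& is_program L x, haltsE x & `[< hard T x >]]]|.

Definition hard_nonhalting T n : nat :=
  #|[set x : n.-tuple Sigma | [&& is_program L x, ~~ haltsE x & `[< hard T x >]]]|.

End VariantE.

(* Main.v *)
Require Import Defs.
From mathcomp Require Import all_boot all_order all_algebra boolp reals.
From mathcomp Require Import classical_sets.

Set Implicit Arguments.
Unset Strict Implicit.
Unset Printing Implicit Defensive.

Import Order.TTheory GRing.Theory Num.Theory.
Local Open Scope ring_scope.

(** The tester reads at most the first [N] symbols of its input and looks the
    answer up in a finite table.  Whenever the prefix of length [N] of [x]
    already contains the actual program, it has the same behaviour as [x], so
    [x] is answered correctly.  The proportion [p(n) / s^n] of programs among
    the [s^n] words of length [n] is nondecreasing, because extending a program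
    by a dead segment gives a program, and it is bounded by 1.  Hence for [N]
    large enough, the proportion of those words of length [n] that are programs
    but whose prefix of length [N] is not is at most [c * p(n) / s^n]. *)

Section PrefixMachine.
Variables (Sigma : finType) (A : Type) (N : nat) (f : seq Sigma -> option A).

(* The flag tells that reading is over; the machine then answers [f w], or
   loops forever if [f w] is [None]. *)
Definition prefix_tm : tm Sigma A :=
  @TM Sigma A (N.-bseq Sigma * bool)%type void ([bseq], false)
    (fun q => if q.2 then f q.1 else None)
    (fun q s =>
       if q.2 then (q, s, Stay) else
       match s with
       | Some (inl a) =>
           if (size q.1 < N)%N
           then ((insub_bseq N (rcons q.1 a), false), s, MoveRight)
           else ((q.1, true), s, Stay)
       | _ => ((q.1, true), s, Stay)
       end).

Lemma write_same (T : Type) (t : int -> T) (h : int) :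
  (fun z => if z == h then t h else t z) = t.
Proof. by apply: funext => z; case: eqP => // ->. Qed.

(** Each reading step stores one symbol in the state, writes it back and moves one cell right, so
    the initial tape survives. *)
Lemma prefix_tm_reading (x : seq Sigma) (k : nat) :
  (k <= N)%N -> (k <= size x)%N ->
  exists2 w : N.-bseq Sigma, take k x = w &
    iter k (@tm_step _ _ prefix_tm) (tm_init prefix_tm x) =
    TMConfig (M := prefix_tm) (w, false) k%:Z (cfg_tape (tm_init prefix_tm x)).
Proof.
elim: k => [|k IHk] leN lex; first by exists [bseq]; rewrite ?take0.
have [w wE iterE] := IHk (ltnW leN) (ltnW lex).
have [a xk] : exists a, onth x k = Some a.
  by have := onthTE x k; rewrite lex; case: onth => // a _; exists a.
have szw : size w = k by rewrite -wE size_takel // ltnW.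
exists (insub_bseq N (rcons w a)).
  rewrite /insub_bseq val_insubd /= size_rcons szw leN -wE.
  by rewrite (take_nth a) // (onth_nth a _ _ _ xk).
rewrite iterS iterE /tm_step /= xk /= szw leN /=; congr TMConfig.
  by rewrite intS addrC.
by rewrite -[RHS](@write_same _ _ k%:Z) /= xk.
Qed.

(** Reading takes [minn N (size x)] steps; one further step, with a full state or on a blank, raises
    the flag. Afterwards the state is frozen, by halting or by looping, hence the arbitrary [j]. *)
Lemma prefix_tm_done (x : seq Sigma) (j : nat) :
  exists2 w : N.-bseq Sigma, take N x = w &
    cfg_state (iter (j + (minn N (size x)).+1)
                 (@tm_step _ _ prefix_tm) (tm_init prefix_tm x)) = (w, true).
Proof.
elim: j => [|j [w wE IHj]].
  have [w wE iterE] :=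
    prefix_tm_reading (geq_minl N (size x)) (geq_minr _ _).
  exists w.
    rewrite -wE /minn; case: ltnP => // leNx.
    by rewrite take_size take_oversize.
  rewrite add0n iterS iterE /tm_step /=.
  have [ltNx|leNx] := ltnP N (size x).
    case: onth => [a|] //=.
    by rewrite -wE size_takel ?geq_minr // (minn_idPl (ltnW ltNx)) ltnn.
  by rewrite onth_default.
exists w => //; rewrite addSn iterS /tm_step.
case E : (tm_answer _) => [b|]; first exact: IHj.
by rewrite IHj /=.
Qed.

Lemma halts_with_prefix_tm (x : seq Sigma) (a : A) :
  halts_with prefix_tm x a <-> f (take N x) = Some a.
Proof.
split=> [[k]|fx]; last first.
  have [w wE stE] := prefix_tm_done x 0.
  by exists (0 + (minn N (size x)).+1)%N; rewrite stE /= -wE.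
(* While the flag is down no answer is given, so [k] must exceed the reading time. *)
have [|lek] := leqP k (minn N (size x)).
  rewrite leq_min => /andP[leN lex].
  by have [w _ ->] := prefix_tm_reading leN lex.
have [w wE] := prefix_tm_done x (k - (minn N (size x)).+1).
by rewrite subnK // => -> /=; rewrite -wE.
Qed.

End PrefixMachine.

Lemma bounded_nondecreasing_tail (R : realType) (a : nat -> R) (b c : R) :
  (forall n, 0 <= a n) -> (forall n, a n <= b) ->
  (forall m n, (m <= n)%N -> a m <= a n) -> 0 < c ->
  exists N, forall n, (N <= n)%N -> a n - a N <= c * a n.
Proof.
move=> a_ge0 a_le a_mono c_gt0.
have [[k ak_gt0]|a_eq0] := pselect (exists k, 0 < a k); last first.
  exists 0%N => n _; have -> : a n = 0.
    apply/eqP; rewrite eq_le a_ge0 andbT leNgt.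
    by apply/negP => an_gt0; apply: a_eq0; exists n.
  by rewrite mulr0 sub0r oppr_le0.
have supa : has_sup (range a).
  by split; [exists (a 0%N), 0%N | exists b => _ [n _ <-]].
(* The tolerance [c * a k] is positive and independent of [n]; from index [k] on it is at most
   [c * a n]. *)
have [_ [m _ <-] ltm] := sup_adherent (mulr_gt0 c_gt0 ak_gt0) supa.
exists (maxn m k) => n; rewrite geq_max => /andP[_ lekn].
have an_le : a n <= sup (range a) by apply: sup_upper_bound => //; exists n.
apply: (@le_trans _ _ (c * a k)); last by rewrite ler_pM2l // a_mono.
rewrite lerBlDl -lerBlDr (le_trans _ (a_mono _ _ (leq_maxl m k))) //.
by apply: ltW; apply: le_lt_trans ltm; rewrite lerB.
Qed.

(** Concatenation is a bijection onto this set from the pairs of an [m]-tuple satisfying [P] and an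
    arbitrary [k]-tuple. *)
Lemma card_tuple_take (T : finType) (m k : nat) (P : pred (seq T)) :
  #|[set x : (m + k).-tuple T | P (take m x)]| =
  (#|[set x : m.-tuple T | P x]| * #|T| ^ k)%N.
Proof.
rewrite -card_tuple -cardsT -cardsX.
pose cat2 (u : m.-tuple T * k.-tuple T) := cat_tuple u.1 u.2.
have cat2_inj : injective cat2.
  move=> [x y] [x' y'] /(congr1 val) /= /eqP.
  rewrite eqseq_cat ?size_tuple // => /andP[/eqP xE /eqP yE].
  by congr pair; apply: val_inj.
rewrite -(card_imset _ cat2_inj); congr #|pred_of_set _|; apply/setP => x.
rewrite inE; apply/idP/imsetP => [Px|[[y z]]].
  have sz1 : size (take m x) == m by rewrite size_takel // size_tuple leq_addr.
  have sz2 : size (drop m x) == k by rewrite size_drop size_tuple addKn.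
  exists (Tuple sz1, Tuple sz2); first by rewrite !inE andbT.
  by apply: val_inj; rewrite /= cat_take_drop.
rewrite !inE andbT => Py -> /=.
by rewrite take_size_cat ?size_tuple.
Qed.

Section DeadSegment.
Variables (Sigma : finType) (L : language Sigma).
Hypothesis eofL : eof_dead_segment L.

Lemma is_program_cat (x d : seq Sigma) : is_program L x -> is_program L (x ++ d).
Proof.
case: eofL => actual [_ progE _] /progE[q [e [-> actq]]].
by apply/progE; exists q, (e ++ d); rewrite catA.
Qed.

Lemma haltsE_cat (x d : seq Sigma) :
  is_program L x -> haltsE L (x ++ d) = haltsE L x.
Proof.
case: eofL => actual [_ progE runE] /progE[q [e [-> actq]]].
by rewrite /haltsE -catA !runE.
Qed.

Lemma num_programs_take (N k : nat) :
  #|[set x : (N + k).-tuple Sigma | is_program L x && is_program L (take N x)]|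
  = (num_programs L N * #|Sigma| ^ k)%N.
Proof.
rewrite -card_tuple_take; congr #|pred_of_set _|; apply/setP => x; rewrite !inE.
apply: andb_idl => ptx.
by rewrite -[tval x](cat_take_drop N); apply: is_program_cat.
Qed.

Lemma num_programs_mono (N k : nat) :
  (num_programs L N * #|Sigma| ^ k <= num_programs L (N + k))%N.
Proof.
rewrite -num_programs_take; apply: subset_leq_card.
by apply/fintype.subsetP => x; rewrite !inE => /andP[].
Qed.

(** [haltsE] need not be computable: [prefix_tm N] uses only the finitely many values on words of
    length at most [N], which are built into the machine. The default [d] fixes the kind of tester,
    [None] giving an endless loop. *)
Definition lookup (d : option verdict) (w : seq Sigma) : option verdict :=
  if is_program L w then Some (if haltsE L w then Yes else No) else d.

Variables (N : nat) (d : option verdict).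
Let T := prefix_tm N (lookup d).

Lemma lookup_correct (x : seq Sigma) :
  is_program L (take N x) -> correct_on L T x.
Proof.
move=> ptx; have hE := haltsE_cat (drop N x) ptx.
rewrite cat_take_drop in hE; rewrite /correct_on hE.
rewrite !halts_with_prefix_tm /lookup ptx.
by case: (haltsE L (take N x)); [left | right].
Qed.

Lemma lookup_default (x : seq Sigma) (v : verdict) :
  ~~ is_program L (take N x) -> halts_with T x v <-> d = Some v.
Proof. by move=> /negbTE ptx; rewrite halts_with_prefix_tm /lookup ptx. Qed.

Lemma hard_le (n : nat) :
  (hard_halting L T n + hard_nonhalting L T n <=
   #|[set x : n.-tuple Sigma | is_program L x && ~~ is_program L (take N x)]|)%N.
Proof.
(* The two sets are disjoint, so the sum counts their union. *)
rewrite /hard_halting /hard_nonhalting -cardsUI.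
set A := finset _; set B := finset _.
have -> : A :&: B = finset.set0.
  by apply/setP => x; rewrite !inE; case: haltsE; rewrite ?andbF.
rewrite cards0 addn0; apply: subset_leq_card; apply/fintype.subsetP => x.
by rewrite !inE => /orP[] /and3P[-> _ /asboolP hx];
   apply/negP => ptx; apply: hx; apply: lookup_correct.
Qed.

Lemma hard_short (n : nat) : (n <= N)%N ->
  (hard_halting L T n + hard_nonhalting L T n = 0)%N.
Proof.
move=> lenN; apply/eqP; rewrite -leqn0 (leq_trans (hard_le n)) // leqn0.
rewrite cards_eq0; apply/eqP/setP => x.
by rewrite !inE take_oversize ?size_tuple // andbN.
Qed.

(** Programs of length [N + k] are split by whether their prefix of length [N] is a program; all
    hard ones lie in the class where it is not. *)
Lemma hard_long (k : nat) :
  (hard_halting L T (N + k) + hard_nonhalting L T (N + k) +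
   num_programs L N * #|Sigma| ^ k <= num_programs L (N + k))%N.
Proof.
rewrite -num_programs_take /num_programs.
pose B := [set x : (N + k).-tuple Sigma | is_program L (take N x)].
rewrite -[leqRHS](cardsID B).
rewrite addnC; apply: leq_add.
  by apply: subset_leq_card; apply/fintype.subsetP => x; rewrite !inE.
apply: leq_trans (hard_le _) _.
by apply: subset_leq_card; apply/fintype.subsetP => x; rewrite !inE andbC.
Qed.

End DeadSegment.

(** [N] comes before [d] because the tail estimate concerns only the proportion of programs; thus it
    serves all three kinds of tester. *)
Lemma exists_lookup_bound (R : realType) (Sigma : finType) (L : language Sigma)
    (c : R) :
  (0 < #|Sigma|)%N -> eof_dead_segment L -> 0 < c ->
  exists N, forall d n, let T := prefix_tm N (lookup L d) in
    (hard_halting L T n + hard_nonhalting L T n)%:R / (num_programs L n)%:R <= c.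
Proof.
move=> s_gt0 eofL c_gt0; set s := #|Sigma|.
have sX_gt0 n : 0 < (s ^ n)%:R :> R by rewrite ltr0n expn_gt0 s_gt0.
pose a n : R := (num_programs L n)%:R / (s ^ n)%:R.
(* Scaling by [s ^ k] gives [a n] and [a (n + k)] a common denominator. *)
have aE n k : a n = (num_programs L n * s ^ k)%:R / (s ^ (n + k))%:R.
  by rewrite expnD !natrM -mulf_div divff ?mulr1 // gt_eqF.
have a_ge0 n : 0 <= a n by rewrite divr_ge0.
have a_le1 n : a n <= 1.
  by rewrite ler_pdivrMr // mul1r ler_nat -card_tuple max_card.
have a_mono m n : (m <= n)%N -> a m <= a n.
  move=> lemn; rewrite (aE m (n - m)%N) subnKC // ler_pM2r ?invr_gt0 //.
  by rewrite ler_nat -{2}(subnKC lemn) num_programs_mono.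
have [N tailN] := bounded_nondecreasing_tail a_ge0 a_le1 a_mono c_gt0.
exists N => d n /=; have [lenN|ltNn] := leqP n N.
  by rewrite hard_short // mul0r ltW.
rewrite -(subnKC (ltnW ltNn)); move: (n - N)%N => k {n ltNn}.
have := tailN _ (leq_addr k N).
rewrite (aE N k) /a -mulrBl mulrA ler_pM2r ?invr_gt0 // => tailk.
have hard_le_p := hard_long eofL N d k.
(* Without programs of this length the quotient is [0], since division by [0] yields [0]. *)
have [->|p_neq0] := eqVneq (num_programs L (N + k)) 0%N.
  by rewrite invr0 mulr0 ltW.
rewrite ler_pdivrMr ?ltr0n ?lt0n //; apply: le_trans tailk.
by rewrite lerBrDr -natrD ler_nat.
Qed.

Theorem theorem5 (R : realType) (Sigma : finType) (L : language Sigma)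
    (Sigma_ge2 : (2 <= #|Sigma|)%N) (eofL : eof_dead_segment L) :
  [/\ forall c : R, 0 < c -> exists T : tm Sigma verdict,
        three_wayE L T /\
        forall n : nat, (hard_halting L T n + hard_nonhalting L T n)%:R
                          / (num_programs L n)%:R <= c,
      forall c : R, 0 < c -> exists T : tm Sigma verdict,
        approxE L T /\
        forall n : nat, (hard_halting L T n + hard_nonhalting L T n)%:R
                          / (num_programs L n)%:R <= c
    & forall c : R, 0 < c -> exists T : tm Sigma verdict,
        genericE L T /\
        forall n : nat, (hard_halting L T n + hard_nonhalting L T n)%:R
                          / (num_programs L n)%:R <= c].
Proof.
have s_gt0 : (0 < #|Sigma|)%N by apply: ltnW.
split=> c c_gt0; have [N boundN] := exists_lookup_bound s_gt0 eofL c_gt0.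
- exists (prefix_tm N (lookup L (Some DontKnow))); split=> // x _.
  case: (boolP (is_program L (take N x))) => [/lookup_correct|ptx].
    by left; auto.
  by right; apply/lookup_default.
(* The default [Yes] may be wrong; the bound already allows every program answered by default to be
   hard. *)
- exists (prefix_tm N (lookup L (Some Yes))); split=> // x _.
  case: (boolP (is_program L (take N x))) => [/(lookup_correct eofL)|ptx].
    by move=> /(_ (Some Yes))[[]|[]]; auto.
  by left; apply/lookup_default.
- exists (prefix_tm N (lookup L None)); split=> // x _.
  case: (boolP (is_program L (take N x))) => [/lookup_correct|ptx].
    by left; auto.
  by right=> v /lookup_default; rewrite ptx => /(_ isT).
Qed.
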